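(* Let $j\ge 3$ and let $\alpha=\alpha_1\cdots\alpha_j$ and $\beta=\beta_1\cdots\beta_j$ be permutations in $S_j$ such that $\alpha_1=\beta_1=1$, $\alpha_j=\beta_j$, $\mathrm{des}(\alpha)=\mathrm{des}(\beta)$, and both $\alpha$ and $\beta$ have the minimal overlapping property. Then \[ \sum_{n\ge 0}\frac{t^n}{n!}\sum_{\sigma\in\mathcal{NM}_n(\alpha)} x^{\mathrm{des}(\sigma)}=\sum_{n\ge 0}\frac{t^n}{n!}\sum_{\sigma\in\mathcal{NM}_n(\beta)} x^{\mathrm{des}(\sigma)}, \] i.e. $\alpha$ and $\beta$ are $\mathrm{des}$-c-Wilf equivalent. If in addition $\mathrm{inv}(\alpha)=\mathrm{inv}(\beta)$, then \[ \sum_{n\ge 0}\frac{t^n}{[n]_q!}\sum_{\sigma\in\mathcal{NM}_n(\alpha)} x^{\mathrm{des}(\sigma)}q^{\mathrm{inv}(\sigma)}=\sum_{n\ge 0}\frac{t^n}{[n]_q!}\sum_{\sigma\in\mathcal{NM}_n(\beta)} x^{\mathrm{des}(\sigma)}q^{\mathrm{inv}(\sigma)}, \] i.e. $\alpha$ and $\beta$ are $(\mathrm{des},\mathrm{inv})$-c-Wilf equivalent.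
   Context: $S_n$ is the set of permutations $\sigma=\sigma_1\cdots\sigma_n$ of $\{1,\dots,n\}$. $\mathrm{des}(\sigma)=|\{i:\sigma_i>\sigma_{i+1}\}|$ and $\mathrm{inv}(\sigma)=|\{(i,k):i<k,\ \sigma_i>\sigma_k\}|$. For a sequence $w$ of distinct positive integers, $\mathrm{red}(w)$ is the permutation obtained by replacing the $i$-th smallest entry by $i$. For $\tau\in S_j$ and $\sigma\in S_n$, $\sigma$ has a $\tau$-match starting at position $i$ if $\mathrm{red}(\sigma_i\sigma_{i+1}\cdots\sigma_{i+j-1})=\tau$; $\tau\text{-}\mathrm{mch}(\sigma)$ is the number of $\tau$-matches in $\sigma$, and $\mathcal{NM}_n(\tau)$ is the set of $\sigma\in S_n$ with no $\tau$-match. A permutation $\tau\in S_j$, $j\ge3$, has the minimal overlapping property if the smallest $i$ for which some $\sigma\in S_i$ has $\tau\text{-}\mathrm{mch}(\sigma)=2$ is $i=2j-1$ (so two $\tau$-matches in any permutation share at most one letter). $[n]_q=1+q+\cdots+q^{n-1}$, $[n]_q!=[1]_q[2]_q\cdots[n]_q$, $[0]_q!=1$. *)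

(* Defs.v *)
From mathcomp Require Import all_boot all_order all_fingroup all_algebra.

Set Implicit Arguments.
Unset Strict Implicit.
Unset Printing Implicit Defensive.

Import GRing.Theory.

(* Elements of 'S_n permute {0, ..., n-1}; the one-line notation shifts the
   letters to {1, ..., n}.  Positions in a word remain 0-based. *)
Definition oneline n (s : 'S_n) : seq nat := [seq (s i).+1 | i <- enum 'I_n].

Definition ndes n (s : 'S_n) : nat :=
  #|[set i : 'I_n | (i.+1 < n)
                    && (nth 0 (oneline s) i.+1 < nth 0 (oneline s) i)]|.

Definition ninv n (s : 'S_n) : nat :=
  #|[set p : 'I_n * 'I_n | (p.1 < p.2) && (s p.2 < s p.1)]|.

(* Each letter is replaced by its rank; this is the reduction when the letters
   of w are distinct. *)
Definition red (w : seq nat) : seq nat :=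
  [seq count (fun y => y <= x) w | x <- w].

Definition match_at j n (tau : 'S_j) (s : 'S_n) (i : nat) : bool :=
  (i + j <= n) && (red (take j (drop i (oneline s))) == oneline tau).

Definition mch j n (tau : 'S_j) (s : 'S_n) : nat :=
  #|[set i : 'I_n | match_at tau s i]|.

Definition NM j (tau : 'S_j) n : {set 'S_n} := [set s | mch tau s == 0].

Definition minimal_overlapping j (tau : 'S_j) : Prop :=
  (exists s : 'S_(2 * j - 1), mch tau s = 2)
  /\ forall i, i < 2 * j - 1 -> forall s : 'S_i, mch tau s <> 2.

Local Open Scope ring_scope.

Definition qint (R : nzRingType) (q : R) (n : nat) : R := \sum_(k < n) q ^+ k.

Definition qfact (R : nzRingType) (q : R) (n : nat) : R :=
  \prod_(k < n) qint q k.+1.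

(* The field Q(q) of rational functions and its indeterminate q. *)
Definition Qq : fieldType := {fraction {poly rat}}.

Definition qX : Qq := tofrac 'X.

Lemma qfact_neq0 n : qfact qX n != 0.
Proof.
apply/prodf_neq0 => k _.
have -> : qint qX k.+1 = tofrac (\sum_(i < k.+1) 'X^i : {poly rat}).
  by rewrite rmorph_sum; apply: eq_bigr => i _; rewrite rmorphXn.
rewrite tofrac_eq0; apply/eqP => /(congr1 (coefp 0)) /eqP /=.
rewrite coef0 coef_sum big_ord_recl big1 ?addr0 ?coefXn ?oner_eq0 // => i _.
by rewrite coefXn.
Qed.

(* A formal power series in t is given by its sequence of coefficients:
   the polynomials in x over Q, resp. over Q(q), that multiply t^n.  The
   polynomial indeterminate 'X is x. *)
Definition des_gf j (tau : 'S_j) : nat -> {poly rat} :=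
  fun n => (n`!%:R)^-1 *: \sum_(s in NM tau n) 'X^(ndes s).

Definition des_inv_gf j (tau : 'S_j) : nat -> {poly Qq} :=
  fun n => (qfact qX n)^-1 *: \sum_(s in NM tau n) qX ^+ ninv s *: 'X^(ndes s).

(* Main.v *)
(** By inclusion-exclusion over sets S of marked positions, it suffices that for
    each S the permutations having an alpha-match at every position of S and
    those having a beta-match at every position of S carry the same total
    weight.  Minimal overlapping makes both families empty unless the marked
    blocks pairwise share at most one letter.  In that case rearrange the
    letters of one marked block from the order of alpha into the order of beta:
    the two ends of the block keep their letters because alpha and beta agree
    there, so no other marked match and no descent outside the block changes,
    and the inversions between the block and the outside are unaffected. *)

Require Import Defs.
From mathcomp Require Import all_boot all_order all_fingroup all_algebra.
From mathcomp Require Import zify.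

Set Implicit Arguments.
Unset Strict Implicit.
Unset Printing Implicit Defensive.

Import GRing.Theory.

(** * Words, ranks and matches *)

Notation letter s := (nth 0 (oneline s)).

Lemma size_oneline n (s : 'S_n) : size (oneline s) = n.
Proof. by rewrite size_map size_enum_ord. Qed.

Lemma letterE n (s : 'S_n) (k : 'I_n) : letter s k = (s k).+1.
Proof. by rewrite (nth_map k) ?size_enum_ord // nth_ord_enum. Qed.

Lemma letter_inj n (s : 'S_n) k l :
  k < n -> l < n -> letter s k = letter s l -> k = l.
Proof.
move=> hk hl; rewrite (letterE s (Ordinal hk)) (letterE s (Ordinal hl)).
by case=> /val_inj/perm_inj[].
Qed.

Lemma card_ord_le n (a : 'I_n) : #|[pred b : 'I_n | b <= a]| = a.+1.
Proof.
rewrite -sum1_card -(big_mkord (fun b => b <= a) (fun=> 1)).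
rewrite (big_cat_nat (n := a.+1)) //= big_nat_cond.
rewrite (eq_bigl (fun b => (0 <= b < a.+1) && true)); last by move=> b; lia.
rewrite -big_nat_cond sum_nat_const_nat subn0 muln1 big_nat_cond.
by rewrite big_pred0 ?addn0 // => b; lia.
Qed.

Lemma count_mkord j (w : seq nat) (P : pred nat) :
  size w = j -> count P w = #|[pred b : 'I_j | P (nth 0 w b)]|.
Proof.
move=> <-; rewrite -sum1_card -sum1_count (big_nth 0) big_mkord.
by apply: eq_bigl.
Qed.

(** Comparing ranks is comparing the sets of positions they count. Conversely the comparisons fix
    each count: [tau] carries the positions counted at [a] onto the values up to [tau a]. *)
Lemma redP j (tau : 'S_j) (w : seq nat) : size w = j ->
  reflect (forall a b : 'I_j, (nth 0 w a < nth 0 w b) = (tau a < tau b))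
          (red w == oneline tau).
Proof.
move=> sw; have cE := count_mkord _ sw.
apply: (iffP eqP) => [E a b | H].
  have H (c : 'I_j) : count (fun y => y <= nth 0 w c) w = (tau c).+1.
    by rewrite -letterE -E (nth_map 0) ?sw.
  rewrite -[RHS]ltnS -!H; apply/idP/idP => [lt_ab | ].
    rewrite !cE; apply: proper_card; apply/properP; split.
      by apply/subsetP => c; rewrite !inE => /leq_trans; apply; apply: ltnW.
    by exists b; rewrite !inE // -ltnNge.
  apply: contraLR; rewrite -!leqNgt => le_ba.
  by apply: sub_count => y /= /leq_trans; apply.
apply: (@eq_from_nth _ 0) => [|k]; rewrite size_map sw ?size_oneline // => lt_k.
rewrite (nth_map 0) ?sw // cE (letterE tau (Ordinal lt_k)).
rewrite -card_ord_le -[RHS]cardsE -(card_preimset _ (@perm_inj _ tau)).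
rewrite -[LHS]cardsE; apply: eq_card => b; rewrite !inE.
by rewrite leqNgt (H (Ordinal lt_k) b) -leqNgt.
Qed.

Lemma matchP j n (tau : 'S_j) (s : 'S_n) i :
  reflect (i + j <= n /\ forall a b : 'I_j,
             (letter s (i + a) < letter s (i + b)) = (tau a < tau b))
          (match_at tau s i).
Proof.
have nthw (c : 'I_j) : nth 0 (take j (drop i (oneline s))) c = letter s (i + c).
  by rewrite nth_take // nth_drop.
have size_w : i + j <= n -> size (take j (drop i (oneline s))) = j.
  by move=> hi; rewrite size_takel // size_drop size_oneline; lia.
apply: (iffP andP) => -[hi H]; split=> //.
  by move=> a b; rewrite -!nthw; move: a b; apply/redP => //; apply: size_w.
by apply/redP => [|a b]; rewrite ?nthw //; apply: size_w.
Qed.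

(** * Spacing of matches under minimal overlapping *)

(* [s'] is the reduction of the factor of length [m] of [s] at position [i]. *)
Lemma exists_window n (s : 'S_n) i m : i + m <= n ->
  exists s' : 'S_m, forall a b, a < m -> b < m ->
    (letter s' a < letter s' b) = (letter s (i + a) < letter s (i + b)).
Proof.
(* The size of [below a] is the rank, from 0, of the letter at [a] in the factor; it is less than
   [m] because [a] is not below itself. *)
move=> him; pose below (a : nat) := [pred b : 'I_m | letter s (i + b) < letter s (i + a)].
have below_lt (a : 'I_m) : #|below a| < m.
  rewrite -[ltnRHS]card_ord -cardsE -cardsT; apply: proper_card.
  by apply/properP; split; [apply: subsetT | exists a; rewrite !inE ?ltnn].
have mono (a b : 'I_m) : (#|below a| < #|below b|) = (letter s (i + a) < letter s (i + b)).
  apply/idP/idP => [|lt_ab].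
    apply: contraLR; rewrite -!leqNgt => le_ba; apply/subset_leq_card/subsetP => c.
    by rewrite !inE => /leq_trans; apply.
  rewrite -cardsE -[ltnRHS]cardsE; apply: proper_card; apply/properP; split.
    by apply/subsetP => c; rewrite !inE => /ltn_trans; apply.
  by exists a; rewrite !inE ?ltnn.
have f_inj : injective (fun a : 'I_m => Ordinal (below_lt a)).
  move=> a b [] eq_ab; apply/val_inj/eqP.
  have [lt_am lt_bm] := (ltn_ord a, ltn_ord b).
  rewrite -(eqn_add2l i) /=; apply/eqP/(@letter_inj _ s); try by lia.
  have := mono a b; have := mono b a; rewrite eq_ab ltnn.
  by case: ltngtP.
exists (perm f_inj) => a b ha hb.
rewrite (letterE _ (Ordinal ha)) (letterE _ (Ordinal hb)) !permE /= ltnS.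
exact: (mono (Ordinal ha) (Ordinal hb)).
Qed.

Lemma match_gap j (tau : 'S_j) n (s : 'S_n) i k :
  minimal_overlapping tau -> match_at tau s i -> match_at tau s k ->
  i < k -> i + j.-1 <= k.
Proof.
(* Induction on the distance: the factor spanned by two matches that are too
   close must contain a third match strictly between them. *)
move=> [_ no_two]; have [d ltd] := ubnP (k - i).
elim: d n s i k ltd => // d IH n s i k ltd /matchP[hi Hi] /matchP[hk Hk] lt_ik.
rewrite leqNgt; apply/negP => lt_kij.
have him : i + (k - i + j) <= n by lia.
have [s' Hs'] := exists_window s him.
have ms' p : p + j <= k - i + j -> match_at tau s' p = match_at tau s (i + p).
  move=> hp; have lt_p (a : 'I_j) : p + a < k - i + j by have := ltn_ord a; lia.
  apply/matchP/matchP => -[_ H]; split; rewrite ?addnA //; first lia.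
    by move=> a b; rewrite -H Hs' ?addnA.
  by move=> a b; rewrite -H Hs' ?addnA.
have m0 : match_at tau s' 0.
  by rewrite ms' ?leq_addl // addn0; apply/matchP.
have mk : match_at tau s' (k - i).
  by rewrite ms' // subnKC 1?ltnW //; apply/matchP.
(* An inner match at [p] is nearer to 0 than [k - i] is, so induction gives [j.-1 <= p], against
   [p < k - i < j.-1]. *)
have [p /andP[/andP[p0 ltp] mp] | no_mid] :=
    pickP [pred p : 'I_(k - i + j) | (0 < p < k - i) && match_at tau s' p].
  by have := IH _ s' 0 p _ m0 mp p0; lia.
(* With no inner match, [s'] has exactly two matches, and its length is below [2 * j - 1]. *)
have hw : 0 < k - i + j by lia.
have hd : k - i < k - i + j by lia.
apply: (no_two (k - i + j) _ s'); first by lia.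
rewrite /mch -[RHS](_ : #|[set Ordinal hw; Ordinal hd]| = 2); last first.
  by rewrite cards2 -val_eqE /=; lia.
apply: eq_card => p; rewrite !inE -!val_eqE /=.
apply/idP/idP => [mp | /orP[] /eqP -> //].
have [hp _] := matchP _ _ _ mp; have := no_mid p; rewrite /= mp andbT; lia.
Qed.

(** * Rearranging a block of positions *)

Definition in_block i j k := i <= k < i + j.

Lemma in_blockP i j k : in_block i j k -> exists a : 'I_j, k = i + a.
Proof.
move=> /andP[le_ik lt_k]; have lt_a : k - i < j by lia.
by exists (Ordinal lt_a) => /=; lia.
Qed.

Lemma exists_block_perm j n (g : 'S_j) i : i + j <= n ->
  exists r : 'S_n,
    (forall k : 'I_n, ~~ in_block i j k -> r k = k)
    /\ (forall (k : 'I_n) (a : 'I_j), k = i + a :> nat -> r k = i + g a :> nat).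
Proof.
move=> hi; have lt_blk (a : 'I_j) : i + a < n by have := ltn_ord a; lia.
pose blk a := Ordinal (lt_blk a).
(* Truncated subtraction sends each [k < i] to 0, which [insub] may accept; the test [i <= k]
   excludes these. *)
pose f (h : 'S_j) (k : 'I_n) :=
  if insub (k - i) is Some a then if i <= k then blk (h a) else k else k.
have f_out h (k : 'I_n) : ~~ in_block i j k -> f h k = k.
  rewrite /in_block /f => out_k; case: insubP => // a lt_a _.
  by case: leqP => // le_ik; case/negP: out_k; lia.
have f_in h a : f h (blk a) = blk (h a).
  by rewrite /f /= addKn valK leq_addr.
have fK : cancel (f g) (f g^-1%g).
  move=> k; have [/andP[le_ik lt_kij] | out_k] := boolP (in_block i j k).
    have lt_kj : k - i < j by lia.
    have -> : k = blk (Ordinal lt_kj) by apply: val_inj => /=; lia.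
    by rewrite !f_in permK.
  by rewrite !f_out.
exists (perm (can_inj fK)); split=> [k out_k | k a def_k]; rewrite permE; first exact: f_out.
by rewrite (_ : k = blk a) ?f_in //; apply: val_inj.
Qed.

Section BlockRearrangement.

Variables (j n i : nat) (g : 'S_j) (r : 'S_n).
Hypotheses
  (r_out : forall k : 'I_n, ~~ in_block i j k -> r k = k)
  (r_in : forall (k : 'I_n) (a : 'I_j), k = i + a :> nat -> r k = i + g a :> nat).

(** In [r * s] the factor [r] acts first, so it permutes positions and not values. *)
Lemma letter_out (s : 'S_n) k : ~~ in_block i j k -> letter (r * s)%g k = letter s k.
Proof.
move=> out_k; have [lt_kn | le_nk] := ltnP k n.
  by rewrite !(letterE _ (Ordinal lt_kn)) permM r_out.
by rewrite !nth_default ?size_oneline.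
Qed.

Lemma letter_in (s : 'S_n) (a : 'I_j) : i + j <= n ->
  letter (r * s)%g (i + a) = letter s (i + g a).
Proof.
move=> hi; have lt_k : i + a < n by have := ltn_ord a; lia.
rewrite (letterE _ (Ordinal lt_k)) permM -letterE.
by congr nth; apply: r_in.
Qed.

Lemma in_block_r (k : 'I_n) : in_block i j (r k) = in_block i j k.
Proof.
apply/idP/idP => [|/in_blockP[a def_k]].
  by apply: contraTT => out_k; rewrite r_out.
by rewrite /in_block (r_in def_k); have := ltn_ord (g a); lia.
Qed.

(** The block is an interval that [r] preserves, so a position outside stays on the same side of
    it. *)
Lemma ltn_block_r (p q : 'I_n) :
  ~~ (in_block i j p && in_block i j q) -> (r p < r q) = (p < q).
Proof.
have [/in_blockP[a def_p] | out_p] := boolP (in_block i j p).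
  move=> out_q; rewrite (r_out out_q) (r_in def_p) def_p.
  by move: out_q; rewrite /in_block; have := ltn_ord a; have := ltn_ord (g a); lia.
have [/in_blockP[a def_q] _ | out_q _] := boolP (in_block i j q).
  rewrite (r_out out_p) (r_in def_q) def_q.
  by move: out_p; rewrite /in_block; have := ltn_ord a; have := ltn_ord (g a); lia.
by rewrite !r_out.
Qed.

End BlockRearrangement.

(** * Descents and inversions inside a block *)

(** As a sum over adjacent pairs, the descent number can be cut at the two ends of a block. *)
Lemma ndes_sum n (s : 'S_n) :
  ndes s = \sum_(0 <= k < n.-1) (letter s k.+1 < letter s k).
Proof.
case: n s => [|n] s.
  by rewrite big_geq // /ndes; apply: eq_card0 => k; have := ltn_ord k.
rewrite /ndes -sum1dep_card big_mkord big_mkcond big_ord_recr /= ltnn addn0.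
by apply: eq_bigr => k _; rewrite ltnS ltn_ord /=; case: (_ < letter s k).
Qed.

Definition inv_set n (s : 'S_n) :=
  [set p : 'I_n * 'I_n | (p.1 < p.2) && (s p.2 < s p.1)].

(** Translation by [i] carries the inversions of [tau] onto those of [s] within the block. *)
Lemma match_ninv_block j (tau : 'S_j) n (s : 'S_n) i : match_at tau s i ->
  #|[set p in inv_set s | in_block i j p.1 && in_block i j p.2]| = ninv tau.
Proof.
move=> /matchP[hi H]; have lt_blk (a : 'I_j) : i + a < n by have := ltn_ord a; lia.
pose blk a := Ordinal (lt_blk a).
have blk_inj : injective (fun p : 'I_j * 'I_j => (blk p.1, blk p.2)).
  by move=> [a b] [c d] /= [/addnI/val_inj -> /addnI/val_inj ->].
have Hs (a b : 'I_j) : (s (blk a) < s (blk b)) = (tau a < tau b).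
  by rewrite -H (letterE s (blk a)) (letterE s (blk b)) ltnS.
rewrite /ninv -(card_imset _ blk_inj); apply: eq_card => -[p q].
rewrite !inE /=; apply/andP/imsetP => [[/andP[lt_pq inv_pq]] | [[a b]]].
  move=> /andP[/in_blockP[a def_p] /in_blockP[b def_q]].
  have Ep : p = blk a by apply: val_inj.
  have Eq : q = blk b by apply: val_inj.
  exists (a, b); last by rewrite Ep Eq.
  by rewrite inE /= -Hs -Ep -Eq inv_pq; move: lt_pq; rewrite Ep Eq /=; lia.
rewrite inE /= => /andP[lt_ab inv_ab] [-> ->]; rewrite Hs inv_ab /= /in_block.
by have := ltn_ord a; have := ltn_ord b; lia.
Qed.

Lemma ndes_match_block j (tau : 'S_j) n (s : 'S_n) i : match_at tau s i ->
  \sum_(i <= k < i + j.-1) (letter s k.+1 < letter s k) = ndes tau.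
Proof.
move=> /matchP[hi H]; rewrite ndes_sum -{1}[i]add0n big_addn addKn.
apply: eq_big_nat => k /andP[_ lt_k].
have lt_k1 : k.+1 < j by lia.
rewrite (letterE tau (Ordinal lt_k1)) (letterE tau (Ordinal (ltnW lt_k1))) ltnS.
by rewrite -H /= addnS !(addnC i).
Qed.

(** * Exchanging a single match *)

(** The same [r] serves every [s], so left multiplication by it can reindex a sum. *)
Lemma exists_swap j (alpha beta : 'S_j) n i : 0 < j ->
  letter alpha 0 = letter beta 0 -> letter alpha j.-1 = letter beta j.-1 ->
  i + j <= n ->
  exists r : 'S_n,
    [/\ forall s, match_at beta (r * s)%g i = match_at alpha s i,
        forall s k, (k <= i) || (i + j.-1 <= k) -> letter (r * s)%g k = letter s k
      & forall s, match_at alpha s i ->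
          ninv (r * s)%g + ninv alpha = ninv s + ninv beta].
Proof.
(* [g a] is the position where [alpha] has the letter that [beta] has at [a]; hence [g] fixes both
   ends. *)
move=> j_gt0 eq_first eq_last hi; pose g := (beta * alpha^-1)%g.
have [r [r_out r_in]] := exists_block_perm g hi.
have g_fix (a : 'I_j) : letter alpha a = letter beta a -> g a = a.
  by rewrite !letterE permM => -[] /val_inj <-; rewrite permK.
have match_r s : match_at beta (r * s)%g i = match_at alpha s i.
  apply/matchP/matchP => -[_ H]; split=> // a b; last first.
    by rewrite !(letter_in r_in) // H !permM !permKV.
  have /= := H (g^-1%g a) (g^-1%g b).
  by rewrite !(letter_in r_in) // !permKV invMg invgK !permM !permKV.
exists r; split=> // [s k out_k | s match_s].
  have [/andP[le_ik lt_k] | ] := boolP (in_block i j k); last exact: letter_out.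
  have lt0 : j.-1 < j by lia.
  have [->|->] : k = i + Ordinal j_gt0 \/ k = i + Ordinal lt0 by rewrite /=; lia.
    by rewrite (letter_in r_in) // g_fix.
  by rewrite (letter_in r_in) // g_fix.
have ninvE (s' : 'S_n) : ninv s' = #|inv_set s'| by [].
pose B := [set p : 'I_n * 'I_n | in_block i j p.1 && in_block i j p.2].
have inE_B (s' : 'S_n) : inv_set s' :&: B =
    [set p in inv_set s' | in_block i j p.1 && in_block i j p.2].
  by apply/setP => p; rewrite !inE.
rewrite !ninvE -(cardsID B (inv_set s)) -(cardsID B (inv_set (r * s)%g)) !inE_B.
rewrite (match_ninv_block match_s).
have := match_r s; rewrite match_s => /match_ninv_block ->.
pose rr (p : 'I_n * 'I_n) := (r p.1, r p.2).
have rr_inj : injective rr by move=> [a b] [c d] [/perm_inj -> /perm_inj ->].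
(* Pairs inside the block contribute [ninv alpha] before and [ninv beta] after; inversions of all
   other pairs correspond under [r]. *)
suff -> : inv_set (r * s)%g :\: B = rr @^-1: (inv_set s :\: B).
  by rewrite card_preimset //; lia.
apply/setP => -[p q]; rewrite !inE /= !permM !(in_block_r r_out r_in).
by have [//|out_pq] := boolP (in_block i j p && in_block i j q); rewrite (ltn_block_r r_out r_in).
Qed.

(** Both end letters are kept, so the pairs entering and leaving the block compare as before and
    only its inner pairs matter. *)
Lemma ndes_local_change j (alpha beta : 'S_j) n (s s' : 'S_n) i : 0 < j ->
  (forall k, (k <= i) || (i + j.-1 <= k) -> letter s' k = letter s k) ->
  match_at alpha s i -> match_at beta s' i ->
  ndes s' + ndes alpha = ndes s + ndes beta.
Proof.
move=> j_gt0 eq_out ms ms'.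
have split_des (u : 'S_n) (F := fun k => nat_of_bool (letter u k.+1 < letter u k)) :
    ndes u = \sum_(0 <= k < i) F k + (\sum_(i <= k < i + j.-1) F k
             + \sum_(i + j.-1 <= k < n.-1) F k).
  have [hi _] := matchP _ _ _ ms.
  rewrite ndes_sum (big_cat_nat (n := i)) //=; last by lia.
  by rewrite [in LHS](big_cat_nat (m := i) (n := i + j.-1)) //=; lia.
rewrite !split_des (ndes_match_block ms) (ndes_match_block ms').
have -> : \sum_(0 <= k < i) (letter s' k.+1 < letter s' k)
        = \sum_(0 <= k < i) (letter s k.+1 < letter s k).
  by apply: eq_big_nat => k lt_k; rewrite !eq_out //; lia.
have -> : \sum_(i + j.-1 <= k < n.-1) (letter s' k.+1 < letter s' k)
        = \sum_(i + j.-1 <= k < n.-1) (letter s k.+1 < letter s k).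
  by apply: eq_big_nat => k lt_k; rewrite !eq_out //; lia.
lia.
Qed.

Lemma match_at_ext j (tau : 'S_j) n (s s' : 'S_n) k :
  (forall l, k <= l < k + j -> letter s' l = letter s l) ->
  match_at tau s' k = match_at tau s k.
Proof.
move=> eq_l; have eq_a (a : 'I_j) : letter s' (k + a) = letter s (k + a).
  by apply: eq_l; have := ltn_ord a; lia.
by apply/matchP/matchP => -[hk H]; split=> // a b; rewrite -H !eq_a.
Qed.

(** * Exchanging all marked matches *)

Section Exchange.

Variables (j : nat) (alpha beta : 'S_j).
Hypotheses (j_gt0 : 0 < j) (eq_first : letter alpha 0 = letter beta 0)
  (eq_last : letter alpha j.-1 = letter beta j.-1)
  (min_alpha : minimal_overlapping alpha) (min_beta : minimal_overlapping beta).
Variables (n : nat) (R : nmodType) (w : 'S_n -> R).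
(** An abstract weight lets the [des] and [(des, inv)] statements share one argument. *)
Hypothesis w_swap : forall (s s' : 'S_n) i,
  match_at alpha s i -> match_at beta s' i ->
  (forall k, (k <= i) || (i + j.-1 <= k) -> letter s' k = letter s k) ->
  ninv s' + ninv alpha = ninv s + ninv beta -> w s' = w s.

(* [T] collects the marked positions already converted from [alpha] to [beta]. *)
Definition marked (S T : {set 'I_n}) (s : 'S_n) :=
  [forall i in S, match_at (if i \in T then beta else alpha) s i].

Lemma marked_swap (S T : {set 'I_n}) i :
  i \in S -> i \notin T -> i + j <= n ->
  {in S &, forall k l : 'I_n, k < l -> k + j.-1 <= l} ->
  (\sum_(s | marked S (i |: T) s) w s = \sum_(s | marked S T s) w s)%R.
Proof.
move=> iS iT hi gap.
have [r [match_r out_r inv_r]] := exists_swap j_gt0 eq_first eq_last hi.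
have marked_r s : marked S (i |: T) (r * s)%g = marked S T s.
  apply: eq_forallb_in => k kS; rewrite !inE.
  have [-> | ne_ki] := eqVneq k i; first by rewrite (negPf iT) match_r.
  (* By [gap], another marked block meets the block at [i] in an end position at most, where [r]
     changes no letter. *)
  apply: match_at_ext => l lt_l; apply: out_r.
  case: (ltngtP k i) => [lt_ki | lt_ik | /val_inj eq_ki].
  - by have := gap _ _ kS iS lt_ki; lia.
  - by have := gap _ _ iS kS lt_ik; lia.
  by rewrite eq_ki eqxx in ne_ki.
rewrite (reindex_inj (mulgI r)); apply: eq_big => [s | s]; first exact: marked_r.
rewrite marked_r => /forall_inP/(_ _ iS); rewrite (negPf iT) => ms.
by apply: (@w_swap _ _ i); rewrite ?match_r //; [apply: out_r | apply: inv_r].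
Qed.

Lemma marked_exchange (S : {set 'I_n}) :
  (\sum_(s | [forall i in S, match_at alpha s i]) w s
   = \sum_(s | [forall i in S, match_at beta s i]) w s)%R.
Proof.
(* If the marked blocks do not fit or overlap too much, both sums are empty. *)
have [gapped | not_gapped] := boolP
  [forall k in S, (k + j <= n) && [forall l in S, (k < l) ==> (k + j.-1 <= l)]].
  have bound i : i \in S -> i + j <= n.
    by move=> iS; have /forall_inP/(_ _ iS)/andP[] := gapped.
  have gap : {in S &, forall k l : 'I_n, k < l -> k + j.-1 <= l}.
    move=> k l kS lS; have /forall_inP/(_ _ kS)/andP[_] := gapped.
    by move=> /forall_inP/(_ _ lS)/implyP.
  (* The positions in [t] are converted one at a time; one outside [S] or already converted changes
     nothing. Finally [t] is [enum S]. *)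
  have step (t : seq 'I_n) : (\sum_(s | marked S [set x in t] s) w s
                              = \sum_(s | marked S set0 s) w s)%R.
    elim: t => [|i t IH]; first by rewrite set_nil.
    rewrite -IH set_cons; have [iT | iT] := boolP (i \in [set x in t]).
      by rewrite (setUidPr _) // sub1set.
    have [iS | iS] := boolP (i \in S); first exact: marked_swap (bound _ iS) gap.
    apply: eq_bigl => s; apply: eq_forallb_in => k kS; rewrite in_setU1.
    by rewrite (_ : k == i = false) //; apply: contraNF iS => /eqP <-.
  have := step (enum S); rewrite set_enum => step_S.
  transitivity (\sum_(s | marked S set0 s) w s)%R; last rewrite -step_S.
    by apply: eq_bigl => s; apply: eq_forallb_in => k kS; rewrite inE.
  by apply: eq_bigl => s; apply: eq_forallb_in => k ->.
have none (tau : 'S_j) : minimal_overlapping tau ->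
    forall s : 'S_n, [forall i in S, match_at tau s i] = false.
  move=> min_tau s; apply: contraNF not_gapped => /forall_inP ms.
  apply/forall_inP => k kS; apply/andP; split.
    by have /matchP[] := ms k kS.
  apply/forall_inP => l lS; apply/implyP.
  exact: match_gap min_tau (ms k kS) (ms l lS).
by rewrite !big_pred0 // => s; apply: none.
Qed.

End Exchange.

(** * Inclusion-exclusion and the two weights *)

(** The indicator of having no match is the product of the [1 - m i] over all positions; it expands
    over the sets [S] of positions contributing [- m i]. *)
Lemma NM_inclusion_exclusion j (tau : 'S_j) n (R : comPzRingType) (w : 'S_n -> R) :
  (\sum_(s in NM tau n) w s =
   \sum_(S : {set 'I_n}) (-1) ^+ #|S| *
     \sum_(s | [forall i in S, match_at tau s i]) w s)%R.
Proof.
under [RHS]eq_bigr => S _ do rewrite big_mkcond big_distrr.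
rewrite exchange_big big_mkcond; apply: eq_bigr => s _ /=.
pose m (i : 'I_n) : R := (match_at tau s i)%:R%R.
have prod_forall (A : {pred 'I_n}) (P : pred 'I_n) :
    (\prod_(i in A) (P i)%:R = [forall i in A, P i]%:R :> R)%R.
  have [/forall_inP all_P | ] := boolP [forall i in A, P i].
    by rewrite big1 // => i /all_P ->.
  rewrite negb_forall_in => /exists_inP[i iA /negPf Pi].
  by rewrite (bigD1 i) //= Pi mul0r.
have expand := @bigA_distr R 0%R 1%R *%R%R +%R%R _ (fun i => (- m i)%R) (fun=> 1%R).
transitivity ((\prod_i (- m i + 1)) * w s)%R.
  transitivity ((\prod_(i in 'I_n) (~~ match_at tau s i)%:R) * w s)%R.
    rewrite prod_forall inE cards_eq0.
    rewrite (_ : [forall i in 'I_n, _] = ([set i : 'I_n | match_at tau s i] == set0)).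
      by case: ifP; rewrite (mul1r, mul0r).
    apply/forallP/eqP => [no_i | no_i i]; last first.
      by have := in_set0 i; rewrite -no_i !inE => ->.
    by apply/setP => i; have := no_i i; rewrite !inE /= => /negPf.
  congr (_ * _)%R; apply: eq_big => // i _; rewrite /m.
  by case: match_at; rewrite ?addNr // oppr0 add0r.
rewrite expand mulr_suml; apply: eq_bigr => S _.
rewrite -big_mkcond prodrN prod_forall -mulrA; congr (_ * _)%R.
by case: ifP; rewrite (mul1r, mul0r).
Qed.

Lemma NM_weight_eq j (alpha beta : 'S_j) n (R : comPzRingType) (w : 'S_n -> R) :
  0 < j -> letter alpha 0 = letter beta 0 -> letter alpha j.-1 = letter beta j.-1 ->
  minimal_overlapping alpha -> minimal_overlapping beta ->
  (forall (s s' : 'S_n) i,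
    match_at alpha s i -> match_at beta s' i ->
    (forall k, (k <= i) || (i + j.-1 <= k) -> letter s' k = letter s k) ->
    ninv s' + ninv alpha = ninv s + ninv beta -> w s' = w s) ->
  (\sum_(s in NM alpha n) w s = \sum_(s in NM beta n) w s)%R.
Proof.
move=> j_gt0 eq_first eq_last min_alpha min_beta w_swap.
rewrite !NM_inclusion_exclusion; apply: eq_bigr => S _; congr (_ * _)%R.
exact: marked_exchange.
Qed.

Theorem theorem1p6 (j : nat) (hj : 3 <= j) (alpha beta : 'S_j)
    (halpha1 : nth 0 (oneline alpha) 0 = 1)
    (hbeta1 : nth 0 (oneline beta) 0 = 1)
    (hlast : nth 0 (oneline alpha) j.-1 = nth 0 (oneline beta) j.-1)
    (hdes : ndes alpha = ndes beta)
    (halpha : minimal_overlapping alpha)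
    (hbeta : minimal_overlapping beta) :
  des_gf alpha =1 des_gf beta
  /\ (ninv alpha = ninv beta -> des_inv_gf alpha =1 des_inv_gf beta).
Proof.
have j_gt0 : 0 < j by lia.
have hfirst : letter alpha 0 = letter beta 0 by rewrite halpha1.
have des_eq n (s s' : 'S_n) i :
    match_at alpha s i -> match_at beta s' i ->
    (forall k, (k <= i) || (i + j.-1 <= k) -> letter s' k = letter s k) ->
    ndes s' = ndes s.
  move=> ms ms' eq_out; apply: (@addIn (ndes beta)).
  by rewrite -(ndes_local_change j_gt0 eq_out ms ms') hdes.
split=> [n | hinv n].
  congr (_ *: _)%R; apply: NM_weight_eq => // s s' i ms ms' eq_out _.
  by rewrite (des_eq _ _ _ _ ms ms' eq_out).
(* With [ninv alpha = ninv beta], an exchange preserves [ninv] as well as [ndes]. *)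
congr (_ *: _)%R; apply: NM_weight_eq => // s s' i ms ms' eq_out eq_inv.
rewrite (des_eq _ _ _ _ ms ms' eq_out); congr (_ ^+ _ *: _)%R.
by apply: (@addIn (ninv beta)); rewrite -eq_inv hinv.
Qed.
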